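(* For every nonnegative integer $h$, \[ \left\lfloor \frac{h+1}{16} \right\rfloor \le \operatorname{rpw}(T_h), \] where $T_h$ is the complete binary tree of height $h$ and $\operatorname{rpw}$ denotes row pathwidth.
   Context: $T_h$ denotes the complete binary tree of height $h$, i.e., the binary tree with $2^h$ leaves and all root-to-leaf paths of length $h$ (length is the number of edges). The strong product of graphs $A$ and $B$, denoted $A \boxtimes B$, is the graph with vertex set $V(A)\times V(B)$, where distinct vertices $(v,x),(w,y)$ are adjacent if $v=w$ and $xy\in E(B)$, or $x=y$ and $vw\in E(A)$, or $vw\in E(A)$ and $xy\in E(B)$. For a positive integer $m$, $[m]=\{1,\dots,m\}$. A path decomposition of a graph $H$ is a sequence $(B_1,\dots,B_m)$ of subsets of $V(H)$ such that (i) for every $v\in V(H)$, the set $\{i\in[m]: v\in B_i\}$ is a nonempty interval in $[m]$, and (ii) for every $uv\in E(H)$ there exists $i\in[m]$ with $u,v\in B_i$. Its width is $\max_{i\in[m]}|B_i|-1$. The pathwidth $\operatorname{pw}(H)$ is the minimum width of a path decomposition of $H$. The row pathwidth $\operatorname{rpw}(G)$ of a graph $G$ is the minimum pathwidth of a graph $H$ such that $G$ is isomorphic to a subgraph (not necessarily induced) of $H\boxtimes P$ for some path $P$. *)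

(* Defs.v *)
From mathcomp Require Import all_boot.
From mathcomp Require Import boolp.

Set Implicit Arguments.
Unset Strict Implicit.
Unset Printing Implicit Defensive.

Record sgraph := SGraph {
  vertex :> finType;
  adj : rel vertex;
  adj_sym : symmetric adj;
  adj_irrefl : irreflexive adj }.

Definition strong_adj (A B : sgraph) : rel (A * B) :=
  fun p q => [|| (p.1 == q.1) && adj p.2 q.2,
                 (p.2 == q.2) && adj p.1 q.1
               | adj p.1 q.1 && adj p.2 q.2].

Lemma strong_adj_sym (A B : sgraph) : symmetric (@strong_adj A B).
Proof.
by move=> p q; rewrite /strong_adj (eq_sym p.1) (eq_sym p.2) !(adj_sym p.1)
  !(adj_sym p.2).
Qed.

Lemma strong_adj_irrefl (A B : sgraph) : irreflexive (@strong_adj A B).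
Proof. by move=> p; rewrite /strong_adj !adj_irrefl !andbF. Qed.

Definition strong_product (A B : sgraph) : sgraph :=
  SGraph (@strong_adj_sym A B) (@strong_adj_irrefl A B).

Definition path_adj (n : nat) : rel 'I_n.+1 :=
  fun i j => (i.+1 == j :> nat) || (j.+1 == i :> nat).

Lemma path_adj_sym (n : nat) : symmetric (@path_adj n).
Proof. by move=> i j; rewrite /path_adj orbC. Qed.

Lemma path_adj_irrefl (n : nat) : irreflexive (@path_adj n).
Proof. by move=> i; rewrite /path_adj orbb -[X in _ == X]addn0 -addn1 eqn_add2l. Qed.

(* The path with n edges, hence n + 1 vertices. *)
Definition path_graph (n : nat) : sgraph :=
  SGraph (@path_adj_sym n) (@path_adj_irrefl n).

(* A vertex is a bit string of length at most h; the root is the empty string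
   and the two children of s are false :: s and true :: s. *)
Definition is_child (h : nat) (s t : {bseq h of bool}) : bool :=
  [exists b : bool, val t == b :: val s].

Definition cbt_adj (h : nat) : rel {bseq h of bool} :=
  fun s t => is_child s t || is_child t s.

Lemma cbt_adj_sym (h : nat) : symmetric (@cbt_adj h).
Proof. by move=> s t; rewrite /cbt_adj orbC. Qed.

Lemma cbt_adj_irrefl (h : nat) : irreflexive (@cbt_adj h).
Proof.
move=> s; rewrite /cbt_adj orbb; apply/existsP => -[b /eqP /(congr1 size)] /=.
by move/eqP; rewrite -[X in X == _]addn0 -addn1 eqn_add2l.
Qed.

Definition complete_binary_tree (h : nat) : sgraph :=
  SGraph (@cbt_adj_sym h) (@cbt_adj_irrefl h).

(* The bags are indexed from 0. *)
Definition path_decomposition (H : sgraph) (B : seq {set H}) : Prop :=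
  (forall v : H, exists i j : nat,
     [/\ i <= j, j < size B &
         forall k, k < size B -> (v \in nth set0 B k) = (i <= k <= j)]) /\
  (forall u v : H, adj u v ->
     exists2 i, i < size B & (u \in nth set0 B i) && (v \in nth set0 B i)).

(* The predecessor is truncated, which only matters for the graph without
   vertices: its width is 0 here rather than -1. *)
Definition width (H : sgraph) (B : seq {set H}) : nat :=
  (\max_(X <- B) #|X|).-1.

Definition has_pathwidth_witness (H : sgraph) (k : nat) : Prop :=
  exists2 B : seq {set H}, path_decomposition B & width B = k.

Lemma pathwidth_ex (H : sgraph) : exists k, `[< has_pathwidth_witness H k >].
Proof.
exists (width [:: [set: H]]); apply/asboolP; exists [:: [set: H]] => //.
split=> [v|u v _]; last by exists 0; rewrite //= !inE.
by exists 0, 0; split=> // -[|k] //= _; rewrite inE.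
Qed.

Definition pathwidth (H : sgraph) : nat := ex_minn (pathwidth_ex H).

(* G is isomorphic to the subgraph of K formed by the images under f of the
   vertices and of the edges of G. *)
Definition subgraph_embedding (G K : sgraph) (f : G -> K) : Prop :=
  injective f /\ forall x y : G, adj x y -> adj (f x) (f y).

Definition isomorphic_to_subgraph (G K : sgraph) : Prop :=
  exists f : G -> K, subgraph_embedding f.

Definition has_row_pathwidth_witness (G : sgraph) (k : nat) : Prop :=
  exists2 H : sgraph,
    exists n : nat, isomorphic_to_subgraph G (strong_product H (path_graph n))
    & pathwidth H = k.

Lemma row_pathwidth_ex (G : sgraph) :
  exists k, `[< has_row_pathwidth_witness G k >].
Proof.
exists (pathwidth G); apply/asboolP; exists G => //; exists 0.
exists (fun x => (x, ord0)); split=> [x y []//|x y xy] /=.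
by rewrite /strong_adj /= xy orbT.
Qed.

Definition row_pathwidth (G : sgraph) : nat := ex_minn (row_pathwidth_ex G).

(* Main.v *)
Require Import Defs.
From mathcomp Require Import all_boot all_order all_algebra.
From mathcomp Require Import boolp.
From mathcomp Require Import lra zify.

Set Implicit Arguments.
Unset Strict Implicit.
Unset Printing Implicit Defensive.

Import Order.TTheory GRing.Theory Num.Theory.

(** Suppose that the tree of height [h] lies in the strong product of [H] and a
    path, and fix a path decomposition of [H]. Call the [H]-coordinate of a tree
    vertex its colour and the other coordinate its layer. A colour occurs at
    most once in each layer and an edge changes the layer by at most one, so at
    most 2s+1 vertices of any given colour lie within distance s of a given
    vertex. It is enough to find a bag that contains k+2 colours as soon as
    16k+2 <= h ([crowded_bag]).

    The pathwidth of a tree is bounded below by joining three disjoint subtrees,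
    each of which has some bag meeting it k times: the connection between the
    outer two crosses the bag of the middle one, which is then met k+1 times.
    Here colours are counted, so the connection must avoid the colours of the
    middle subtree ([middle_rich]). As it is not known beforehand which subtree
    is the middle one, the three should have pairwise disjoint colours.

    Disjointness is obtained by choosing the subtrees, called limbs, at random.
    A limb for k+1 colours at v starts from three vertices at depth 2 below v,
    goes down from each of them along a random path to depth 16, and continues
    there with an independent random limb for k colours; the outcome is then
    conditioned on there being no two vertices of one colour in different parts
    of the limb, the deeper at depth at least 16. As a colour has only 2s+1 occurrences within distance s while a
    vertex at depth s belongs to the limb with an exponentially small
    probability, the expected number of such coincidences is below 3/8
    ([clash_mass_lt]). Hence conditioning multiplies probabilities by at most
    8/5, and since 8/5 * 2^-14 <= (9/16)^16 the bound (9/16)^(s-3) on the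
    probability that a limb contains a given vertex at depth s below its root
    is the same for every k ([dominated_limb_step]). For two colours four
    vertices suffice: a claw cannot have a single colour, because there are only two layers next
    to the layer of its centre ([claw_rich]).

    No probability space is needed. Instead of a random member of a family of
    sets with prescribed inclusion probabilities, [dominated] asks that for
    every weight function some member weighs at most what a random one would
    weigh on average; independent choices and conditioning become the method of
    conditional expectations ([dominated_jointly], [dominated_clash_free]). *)

(** * Inclusion probabilities and the expected number of clashes *)

Section Profiles.
Local Open Scope ring_scope.
Variable R : realFieldType.

(** A ratio above 1/2 whose 16th power is at least 8/5 * 2^-14 reproduces itself
    from one limb to the next; it is taken small to keep expected clashes few. *)
Definition decay : R := 9 / 16.
(** Bounds the probability that a limb contains a given vertex at depth [s] below
    its root. The truncated exponent makes it 1 up to depth 3, which covers the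
    vertices that are put into a limb without a random choice. *)
Definition profile (s : nat) : R := decay ^+ (s - 3).
(** The effect on inclusion probabilities of adding a new root and hanging the
    random set below a random child of it. *)
Definition lift_profile (p : nat -> R) (s : nat) : R :=
  if s is s'.+1 then p s' / 2 else 1.
(** A limb at depth 16 is reached from depth 2 by 14 random steps; [arm_profile]
    is seen from depth 3, [branch_profile] from depth 2. *)
Definition arm_profile : nat -> R := iter 13 lift_profile profile.
Definition branch_profile : nat -> R := iter 14 lift_profile profile.

Lemma decay_bounds : 0 <= decay <= 1.
Proof. by rewrite /decay; lra. Qed.

Lemma decay_ge0 : 0 <= decay. Proof. by case/andP: decay_bounds. Qed.
Lemma decay_le1 : decay <= 1. Proof. by case/andP: decay_bounds. Qed.

Lemma decayX_anti (m n : nat) : (m <= n)%N -> decay ^+ n <= decay ^+ m.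
Proof. by move=> mn; rewrite ler_wiXn2l ?decay_ge0 ?decay_le1. Qed.

Lemma iter_lift_profile_small (p : nat -> R) (e s : nat) :
  (s < e)%N -> iter e lift_profile p s = 2^-1 ^+ s.
Proof.
elim: e s => [|e IH] [|s] //= se.
by rewrite IH // exprSr.
Qed.

Lemma iter_lift_profile_large (p : nat -> R) (e s : nat) :
  iter e lift_profile p (e + s) = 2^-1 ^+ e * p s.
Proof.
elim: e => [|e IH] /=; first by rewrite expr0 mul1r.
by rewrite IH exprS -mulrA mulrC mulrA.
Qed.

Lemma iter_lift_profile_ge0 (p : nat -> R) (e s : nat) :
  (forall t, 0 <= p t) -> 0 <= iter e lift_profile p s.
Proof.
move=> p0; elim: e s => [|e IH] //= [|s] /=; first exact: ler01.
by rewrite divr_ge0 ?IH.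
Qed.

Lemma half_le_decay : 2^-1 <= decay. Proof. by rewrite /decay; lra. Qed.

Lemma lifted_weight_le : 8 / 5 * 2^-1 ^+ 14 <= decay ^+ 16.
Proof.
have H4 : 8 / 5 * 2^-1 ^+ 4 <= decay ^+ 4.
  by rewrite /decay !exprS !expr0; lra.
have H16 : (8 / 5 * 2^-1 ^+ 4) ^+ 4 <= decay ^+ 16.
  rewrite (exprM decay 4 4) lerXn2r ?nnegrE ?exprn_ge0 ?decay_ge0 //.
  by rewrite mulr_ge0 ?exprn_ge0 //; lra.
apply: le_trans H16; rewrite exprMn -exprM.
rewrite -[(4 * 4)%N]/(14 + 2)%N exprD mulrA mulrAC ler_wpM2r ?exprn_ge0 //; first lra.
by rewrite !exprS !expr0; lra.
Qed.

(** After conditioning, which costs a factor 8/5, the inclusion probabilities are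
    again bounded by [profile]. The case [s = 0] is left out because conditioning
    does not change the probability 1 of the three vertices at depth 2. *)
Lemma branch_profile_le (s : nat) :
  (0 < s)%N -> 8 / 5 * branch_profile s <= profile s.+2.
Proof.
move=> s0; rewrite /profile -[(s.+2 - 3)%N]/(s - 1)%N subn1.
have [s14|s14] := ltnP s 14.
  rewrite /branch_profile iter_lift_profile_small //.
  case: s s0 s14 => // s _ _; rewrite exprS /=.
  have : 2^-1 ^+ s <= decay ^+ s.
    by rewrite lerXn2r ?nnegrE ?decay_ge0 ?half_le_decay //; lra.
  have : 0 <= 2^-1 ^+ s :> R by rewrite exprn_ge0 //; lra.
  by move=> *; lra.
rewrite -(subnKC s14) /branch_profile iter_lift_profile_large mulrA.
set r := (s - 14)%N.
apply: (@le_trans _ _ (decay ^+ 16 * profile r)).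
  by rewrite ler_wpM2r ?lifted_weight_le // exprn_ge0 ?decay_ge0.
by rewrite /profile -exprD decayX_anti //; lia.
Qed.

Lemma geom_sum_le (M : nat) : \sum_(j < M) decay ^+ j.+1 <= 3 / 2.
Proof.
suff : \sum_(j < M) decay ^+ j.+1 <= 9 / 7 * (1 - decay ^+ M).
  by have := exprn_ge0 M decay_ge0; move=> *; lra.
elim: M => [|M IH]; first by rewrite big_ord0 expr0 subrr mulr0.
rewrite big_ord_recr /= exprS.
have := exprn_ge0 M decay_ge0; move: IH; rewrite /decay; set u := _ ^+ M.
by move=> *; lra.
Qed.

(** Bounds the sum over all layers y of decay ^ (max (a, |y - y0|) - 19): there are
    2a+1 layers within distance a, and the two geometric tails add at most 4. *)
Definition layer_bound (a : nat) : R := decay ^+ (a - 19) * (2 * a%:R + 5).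

Lemma sum_ord_widen (m n : nat) (F : nat -> R) : (m <= n)%N ->
  (forall i, 0 <= F i) -> \sum_(i < m) F i <= \sum_(i < n) F i.
Proof.
move=> mn F0; rewrite -(subnKC mn) big_split_ord /= lerDl.
by apply: sumr_ge0 => i _.
Qed.

Lemma half_layer_sum_le (a M : nat) : (19 <= a)%N ->
  \sum_(d < M) decay ^+ (maxn a d - 19) <= decay ^+ (a - 19) * (a%:R + 5 / 2).
Proof.
move=> a19.
apply: (@le_trans _ _ (\sum_(d < a.+1 + M) decay ^+ (maxn a d - 19))).
  apply: (@sum_ord_widen _ _ (fun d => decay ^+ (maxn a d - 19))); first lia.
  by move=> i; rewrite exprn_ge0 ?decay_ge0.
rewrite big_split_ord /=.
rewrite (eq_bigr (fun _ => decay ^+ (a - 19))); last first.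
  by move=> i _; congr (_ ^+ (_ - _)); have := ltn_ord i; lia.
rewrite [X in _ + X](eq_bigr (fun j : 'I_M => decay ^+ (a - 19) * decay ^+ j.+1)).
  rewrite -mulr_sumr sumr_const card_ord -[X in X + _]mulr_natr -mulrDr.
  rewrite ler_wpM2l ?exprn_ge0 ?decay_ge0 // -natr1.
  by have := geom_sum_le M; move=> *; lra.
by move=> j _; rewrite -exprD; congr (_ ^+ _); lia.
Qed.

Lemma layer_sum_le (a N y0 : nat) : (19 <= a)%N ->
  \sum_(y < N) decay ^+ (maxn a (maxn (y - y0) (y0 - y)) - 19) <= layer_bound a.
Proof.
move=> a19; set G := fun d => decay ^+ (maxn a d - 19).
have G0 d : 0 <= G d by rewrite exprn_ge0 ?decay_ge0.
have half M : \sum_(d < M) G d <= decay ^+ (a - 19) * (a%:R + 5 / 2).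
  exact: half_layer_sum_le.
apply: (@le_trans _ _ (\sum_(y < y0.+1 + N) G (maxn (y - y0) (y0 - y)))).
  by apply: (@sum_ord_widen _ _ (fun y => G (maxn (y - y0) (y0 - y)))); first lia.
rewrite big_split_ord /= (reindex_inj rev_ord_inj) /=.
rewrite (eq_bigr (fun d : 'I_y0.+1 => G d)); last first.
  by move=> d _; congr G; have := ltn_ord d; lia.
have -> : \sum_(i < N) G (maxn (y0.+1 + i - y0) (y0 - (y0.+1 + i)))
    = \sum_(i < N) G i.+1.
  by apply: eq_bigr => i _; congr G; lia.
have : \sum_(i < N) G i.+1 <= \sum_(d < N.+1) G d.
  by rewrite big_ord_recl /= lerDr.
move: (half y0.+1) (half N.+1); rewrite /layer_bound.
by move=> *; lra.
Qed.

(** Bounds the expected number of vertices of a limb, at depth at least 16 and at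
    least [s], that have the colour of a given vertex at depth [s]: the
    probability for a vertex at depth t >= 16 is at most
    2^-14 * decay ^ (t - 19). *)
Definition clash_bound (s : nat) : R :=
  2^-1 ^+ 14 * layer_bound (maxn s 19).

Lemma clash_bound_ge0 s : 0 <= clash_bound s.
Proof.
by rewrite /clash_bound /layer_bound !mulr_ge0 ?addr_ge0 ?mulr_ge0
  ?exprn_ge0 ?decay_ge0 ?invr_ge0.
Qed.

(** The ratio 81/128 is 2 * decay ^ 2, that is, the growth of the number of
    vertices times the decay of the probabilities of both clashing vertices. *)
Lemma tail_sum_le (J : nat) :
  \sum_(j < J) (81 / 128 : R) ^+ j.+1 * (43 + 2 * j.+1%:R) <= 90.
Proof.
(* 90 + 4J is an upper estimate of the rest of the series, divided by its ratio
   to the power J: it satisfies 81/128 * (43 + 2(J+1) + 90 + 4(J+1)) <= 90 + 4J. *)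
suff : \sum_(j < J) (81 / 128 : R) ^+ j.+1 * (43 + 2 * j.+1%:R)
    <= 90 - (81 / 128) ^+ J * (90 + 4 * J%:R).
  have : 0 <= (81 / 128 : R) ^+ J * (90 + 4 * J%:R).
    by rewrite mulr_ge0 ?exprn_ge0 ?addr_ge0 ?mulr_ge0 //; lra.
  by move=> *; lra.
elim: J => [|J IH]; first by rewrite big_ord0 expr0; lra.
rewrite big_ord_recr /= exprS -(natr1 J).
have u0 : 0 <= (81 / 128 : R) ^+ J by rewrite exprn_ge0 //; lra.
have : 0 <= (81 / 128 : R) ^+ J * J%:R by rewrite mulr_ge0.
move: IH u0; move: (_ ^+ J) (J%:R) (\sum_(_ < _) _) => u x S IH u0 ux0.
have -> : 81 / 128 * u * (43 + 2 * (x + 1)) =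
  u * (81 / 128 * 45) + u * x * (81 / 128 * 2) by lra.
have -> : 81 / 128 * u * (90 + 4 * (x + 1)) =
  u * (81 / 128 * 94) + u * x * (81 / 128 * 4) by lra.
move: IH; rewrite mulrDr mulrCA.
by move: (u * x) ux0 => y *; lra.
Qed.

(** The expected number of clashes in one step: the summands are the root, its two
    children, and three subtrees rooted at depth 2. The first 20 levels contribute
    90 * 43 units of 2^-14, the others at most 24 * 90, and 6030 < 3/8 * 2^14. *)
Lemma clash_bound_mass_lt (m : nat) :
  clash_bound 0 + 2 * clash_bound 1 +
  3 * (\sum_(r < m) 2 ^+ r * branch_profile r * clash_bound r.+2) < 3 / 8.
Proof.
set F := fun r => 2 ^+ r * branch_profile r * clash_bound r.+2.
have q0 s : 0 <= branch_profile s.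
  by apply: iter_lift_profile_ge0 => t; rewrite exprn_ge0 ?decay_ge0.
have F0 r : 0 <= F r.
  by apply: mulr_ge0 (clash_bound_ge0 _); apply: mulr_ge0 (q0 _); rewrite exprn_ge0.
have half2 : (2 : R) * 2^-1 = 1 by lra.
pose e : R := 2^-1 ^+ 14.
have e0 : 0 < e by rewrite exprn_gt0 //; lra.
have early s : (s <= 19)%N -> clash_bound s = 43 * e.
  move=> s19; rewrite /clash_bound /layer_bound (maxn_idPr s19) subnn expr0.
  by rewrite -/e; lra.
have low (r : nat) : (r < 14)%N -> F r = 43 * e.
  move=> r14; rewrite /F /branch_profile iter_lift_profile_small // -exprMn half2.
  by rewrite expr1n mul1r early //; lia.
have high r : F (14 + r)%N = 2 ^+ r * profile r * clash_bound (14 + r).+2.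
  rewrite /F /branch_profile iter_lift_profile_large exprD.
  have : (2 : R) ^+ 14 * 2^-1 ^+ 14 = 1 by rewrite -exprMn half2 expr1n.
  move: (2 ^+ 14 : R) (2^-1 ^+ 14 : R) (2 ^+ r : R) (profile r) (clash_bound _).
  by move=> a b c d f ab; rewrite -[LHS]/(a * c * (b * d) * f) mulrACA ab mul1r.
have tail j : F (18 + j)%N = 8 * e * ((81 / 128) ^+ j.+1 * (43 + 2 * j.+1%:R)).
  rewrite -[(18 + j)%N]/(14 + (4 + j))%N high /clash_bound /layer_bound /profile.
  have -> : maxn (14 + (4 + j)).+2 19 = (19 + j.+1)%N by lia.
  have -> : (4 + j = 3 + j.+1)%N by lia.
  rewrite !addKn natrD exprD -/e.
  have -> : 81 / 128 = 2 * decay * decay by rewrite /decay; lra.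
  rewrite !exprMn.
  move: (2 ^+ j.+1 : R) (decay ^+ j.+1) (j.+1%:R : R) => a b c.
  by rewrite !exprS expr0; lra.
apply: (@le_lt_trans _ _ (clash_bound 0 + 2 * clash_bound 1
    + 3 * \sum_(r < 18 + m) F r)).
  by rewrite lerD2l ler_wpM2l //; apply: sum_ord_widen => //; lia.
rewrite big_split_ord /=.
under [X in 3 * (_ + X)]eq_bigr do rewrite tail.
rewrite -mulr_sumr.
rewrite !early //.
have -> : \sum_(i < 18) F i = 29 * (43 * e).
  rewrite -[18%N]/(14 + 4)%N big_split_ord /=.
  rewrite (eq_bigr (fun=> 43 * e)); last by move=> i _; rewrite low.
  rewrite sumr_const card_ord !big_ord_recr big_ord0 /= !high !early //.
  by rewrite /profile !exprS !expr0 -[X in X + _]mulr_natr; lra.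
have := tail_sum_le m; set S := \sum_(_ < _) _ => S90.
have : e * S <= e * 90 by rewrite ler_wpM2l // ltW.
suff : e = 1 / 128 * (1 / 128) by move=> -> *; lra.
rewrite /e -[14%N]/(7 + 7)%N exprD.
have -> : (2^-1 : R) ^+ 7 = 1 / 128 by rewrite !exprS expr0; lra.
by [].
Qed.
End Profiles.

(** * Random sets without probability *)

Section Domination.
Local Open Scope ring_scope.
Variables (R : realFieldType) (T : finType).
Implicit Types (F : {set T} -> Prop) (p q w : T -> R) (A B Q : {set T}).

Definition mean p w : R := \sum_u p u * w u.
Definition ind A (u : T) : R := (u \in A)%:R.
(** By linear programming duality this says that some random member of [F]
    contains each [u] with probability at most [p u]. Weights are required to be
    positive so that the total average weight can serve as a unit. *)
Definition dominated F p : Prop :=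
  forall w, (forall u, 0 < w u) -> exists2 Q, F Q & mean (ind Q) w <= mean p w.

Lemma ind_ge0 A u : 0 <= ind A u. Proof. exact: ler0n. Qed.

Lemma mean_ge0 p w : (forall u, 0 <= p u) -> (forall u, 0 <= w u) -> 0 <= mean p w.
Proof. by move=> p0 w0; apply: sumr_ge0 => u _; apply: mulr_ge0. Qed.

Lemma meanDr p w w' : mean p (fun u => w u + w' u) = mean p w + mean p w'.
Proof. by rewrite -big_split; apply: eq_bigr => u _; rewrite mulrDr. Qed.

Lemma meanDl p q w : mean (fun u => p u + q u) w = mean p w + mean q w.
Proof. by rewrite -big_split; apply: eq_bigr => u _; rewrite mulrDl. Qed.

Lemma meanZr p w (c : R) : mean p (fun u => c * w u) = c * mean p w.
Proof. by rewrite mulr_sumr; apply: eq_bigr => u _; rewrite mulrCA. Qed.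

Lemma meanZl p w (c : R) : mean (fun u => c * p u) w = c * mean p w.
Proof. by rewrite mulr_sumr; apply: eq_bigr => u _; rewrite mulrA. Qed.

Lemma mean_le p q w : (forall u, p u <= q u) -> (forall u, 0 <= w u) ->
  mean p w <= mean q w.
Proof. by move=> pq w0; apply: ler_sum => u _; rewrite ler_wpM2r. Qed.

Lemma mean_ler p w w' : (forall u, 0 <= p u) -> (forall u, w u <= w' u) ->
  mean p w <= mean p w'.
Proof. by move=> p0 ww'; apply: ler_sum => u _; rewrite ler_wpM2l. Qed.

Lemma mean_pred1 (v : T) w : mean (fun u => (u == v)%:R) w = w v.
Proof.
rewrite /mean (bigD1 v) //= eqxx mul1r big1 ?addr0 // => u /negPf ->.
by rewrite mul0r.
Qed.

Lemma mean_indU A B w : (forall u, 0 <= w u) ->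
  mean (ind (A :|: B)) w <= mean (ind A) w + mean (ind B) w.
Proof.
move=> w0; rewrite -meanDl; apply: mean_le => // u.
rewrite /ind in_setU; case: (u \in A); case: (u \in B);
by rewrite ?addr0 ?add0r ?lerDl.
Qed.

(** The expectation of the sum of [K] over pairs, for independent random sets with
    inclusion probabilities [p] and [q]. *)
Definition pairing (p q : T -> R) (K : T -> T -> R) : R :=
  mean p (fun u => mean q (K u)).

Lemma pairingC p q K : pairing p q K = mean q (fun u' => mean p (K^~ u')).
Proof.
rewrite /pairing /mean.
under eq_bigr do rewrite mulr_sumr.
rewrite exchange_big /=; apply: eq_bigr => u' _; rewrite mulr_sumr.
by apply: eq_bigr => u _; rewrite mulrCA.
Qed.

Lemma pairing_swap p q K : pairing p q (fun u u' => K u' u) = pairing q p K.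
Proof. by rewrite pairingC. Qed.

Lemma eq_mean p w w' : (forall u, w u = w' u) -> mean p w = mean p w'.
Proof. by move=> ww'; apply: eq_bigr => u _; rewrite ww'. Qed.

Lemma pairingDk p q K L :
  pairing p q (fun u u' => K u u' + L u u') = pairing p q K + pairing p q L.
Proof. by rewrite /pairing -meanDr; apply: eq_mean => u; rewrite meanDr. Qed.

Lemma pairingZk p q K (c : R) : pairing p q (fun u u' => c * K u u') = c * pairing p q K.
Proof. by rewrite /pairing -meanZr; apply: eq_mean => u; rewrite meanZr. Qed.

Lemma pairingDl p p' q K :
  pairing (fun u => p u + p' u) q K = pairing p q K + pairing p' q K.
Proof. exact: meanDl. Qed.

Lemma pairingDr p q q' K :
  pairing p (fun u => q u + q' u) K = pairing p q K + pairing p q' K.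
Proof. by rewrite /pairing -meanDr; apply: eq_mean => u; rewrite meanDl. Qed.

Lemma pairing_ge0 p q K : (forall u, 0 <= p u) -> (forall u, 0 <= q u) ->
  (forall u u', 0 <= K u u') -> 0 <= pairing p q K.
Proof. by move=> p0 q0 K0; apply: mean_ge0 => // u; apply: mean_ge0. Qed.

(** The method of conditional expectations. The objective is linear in each of the
    three sets, so the sets can be chosen one after the other, each time against
    the sets already chosen and the averages of the others. *)
Lemma dominated_jointly F1 F2 F3 p1 p2 p3 (a : T -> R) (S : T -> T -> R) :
  dominated F1 p1 -> dominated F2 p2 -> dominated F3 p3 ->
  (forall u, 0 <= p2 u) -> (forall u, 0 <= p3 u) ->
  (forall u, 0 < a u) -> (forall u u', 0 <= S u u') ->
  exists Q1 Q2 Q3, [/\ F1 Q1, F2 Q2, F3 Q3 &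
    mean (ind Q1) a + mean (ind Q2) a + mean (ind Q3) a
    + pairing (ind Q1) (ind Q2) S + pairing (ind Q1) (ind Q3) S
    + pairing (ind Q2) (ind Q3) S
    <= mean p1 a + mean p2 a + mean p3 a
    + pairing p1 p2 S + pairing p1 p3 S + pairing p2 p3 S].
Proof.
move=> D1 D2 D3 p20 p30 a0 S0.
have pos b c : (forall u, 0 <= b u) -> (forall u, 0 <= c u) ->
    forall u, 0 < a u + (b u + c u).
  by move=> b0 c0 u; apply: ltr_wpDr => //; apply: addr_ge0.
have mS0 p u : (forall u, 0 <= p u) -> 0 <= mean p (S u) by move=> ?; apply: mean_ge0.
have mS0' p u : (forall u, 0 <= p u) -> 0 <= mean p (S^~ u).
  by move=> ?; apply: mean_ge0.
have [|Q1 F1Q1] := D1 (fun u => a u + (mean p2 (S u) + mean p3 (S u))).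
  by apply: pos => u; apply: mS0.
have [|Q2 F2Q2] := D2 (fun u => a u + (mean (ind Q1) (S^~ u) + mean p3 (S u))).
  by apply: pos => u; [apply: mS0' => ?; apply: ind_ge0|apply: mS0].
have [|Q3 F3Q3] := D3 (fun u => a u + (mean (ind Q1) (S^~ u) + mean (ind Q2) (S^~ u))).
  by apply: pos => u; apply: mS0' => ?; apply: ind_ge0.
rewrite !meanDr -(pairingC (ind Q1) (ind Q3)) -(pairingC (ind Q2) (ind Q3)).
rewrite -(pairingC (ind Q1) p3) -(pairingC (ind Q2) p3) => H3.
rewrite -(pairingC (ind Q1) (ind Q2)) -(pairingC (ind Q1) p2) => H2 H1.
rewrite /pairing in H1 H2 H3 *.
by exists Q1, Q2, Q3; split=> //; lra.
Qed.

Definition clash_free (K : rel T) A B : Prop :=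
  forall u u', u \in A -> u' \in B -> ~~ K u u'.

Lemma clash_freeP (K : rel T) A B :
  pairing (ind A) (ind B) (fun u u' => (K u u')%:R) < 1 -> clash_free K A B.
Proof.
rewrite ltNge => /negP H u u' uA uB; apply/negP => Kuu'; apply: H.
have n0 (b : bool) : 0 <= b%:R :> R by apply: ler0n.
rewrite /pairing /mean (bigD1 u) //= (bigD1 u') //= Kuu' /ind uA uB !mul1r.
rewrite -addrA lerDl addr_ge0 ?sumr_ge0 // => x _; rewrite mulr_ge0 //.
by apply: sumr_ge0 => y _; rewrite mulr_ge0.
Qed.

(** Conditioning on the absence of clashes. With W the average total weight, each
    clash is charged 8/5 * W. The expected total is then less than
    W + 8/5 * W * 3/8 = 8/5 * W, so a choice that does not exceed it has no clash
    and weighs at most 8/5 * W. [P] also counts clashes within one set; this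
    is harmless and makes the hypothesis a single pairing. *)
Lemma dominated_clash_free F1 F2 F3 p1 p2 p3 (Sh : T -> R) A (K : rel T) :
  dominated F1 p1 -> dominated F2 p2 -> dominated F3 p3 ->
  (forall u, 0 <= p1 u) -> (forall u, 0 <= p2 u) -> (forall u, 0 <= p3 u) ->
  (exists u, 0 < p1 u) -> (forall u, ind A u <= Sh u) ->
  let P u := Sh u + p1 u + p2 u + p3 u in
  pairing P P (fun u u' => (K u u')%:R) < 3 / 8 ->
  forall w, (forall u, 0 < w u) ->
  exists Q1 Q2 Q3, [/\ F1 Q1, F2 Q2 & F3 Q3] /\
    [/\ mean (ind Q1) w + mean (ind Q2) w + mean (ind Q3) w
        <= 8 / 5 * (mean p1 w + mean p2 w + mean p3 w),
      [/\ clash_free K A Q1, clash_free K A Q2 & clash_free K A Q3],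
      [/\ clash_free K Q1 Q2, clash_free K Q1 Q3 & clash_free K Q2 Q3] &
      [/\ clash_free K Q2 Q1, clash_free K Q3 Q1 & clash_free K Q3 Q2]].
Proof.
move=> D1 D2 D3 p10 p20 p30 [x px] Ash P small w w0.
pose k u u' : R := (K u u')%:R.
have k0 u u' : 0 <= k u u' by apply: ler0n.
have Sh0 u : 0 <= Sh u by apply: le_trans (Ash u); apply: ind_ge0.
have w0' u : 0 <= w u by apply: ltW.
set W := mean p1 w + mean p2 w + mean p3 w.
have W0 : 0 < W.
  rewrite /W -addrA ltr_wpDr //; first by rewrite addr_ge0 ?mean_ge0.
  rewrite /mean (bigD1 x) //= ltr_wpDr ?mulr_gt0 //.
  by apply: sumr_ge0 => u _; apply: mulr_ge0.
pose lam := 8 / 5 * W.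
have lam0 : 0 < lam by rewrite mulr_gt0 //; lra.
pose a u := w u + lam * mean (ind A) (k^~ u).
pose S u u' := lam * (k u u' + k u' u).
have [| |Q1 [Q2 [Q3 [F1Q1 F2Q2 F3Q3]]]] :=
  dominated_jointly (a := a) (S := S) D1 D2 D3 p20 p30.
- move=> u; apply: ltr_wpDr (w0 u); apply: mulr_ge0 (ltW lam0) _.
  by apply: mean_ge0 => // ?; apply: ind_ge0.
- by move=> u u'; rewrite /S mulr_ge0 ?addr_ge0 // ltW.
have aE p : mean p a = mean p w + lam * pairing (ind A) p k.
  by rewrite /a meanDr meanZr pairingC.
have SE p q : pairing p q S = lam * (pairing p q k + pairing q p k).
  by rewrite /S pairingZk pairingDk (pairing_swap p q k).
rewrite !aE !SE.
set EL := (X in _ <= X) => le_E.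
have f0 p q : (forall u, 0 <= p u) -> (forall u, 0 <= q u) -> 0 <= pairing p q k.
  by move=> p0 q0; apply: pairing_ge0.
have fA p : (forall u, 0 <= p u) -> pairing (ind A) p k <= pairing Sh p k.
  by move=> p0; apply: mean_le => // u; apply: mean_ge0.
have lt_E : EL < lam.
  have : pairing P P k < 3 / 8 by [].
  rewrite /P !pairingDl !pairingDr.
  move: (f0 _ _ Sh0 Sh0) (f0 _ _ p10 p10) (f0 _ _ p20 p20) (f0 _ _ p30 p30).
  move: (f0 _ _ p10 Sh0) (f0 _ _ p20 Sh0) (f0 _ _ p30 Sh0).
  move: (fA _ p10) (fA _ p20) (fA _ p30) => *.
  have : lam * (pairing (ind A) p1 k + pairing (ind A) p2 k + pairing (ind A) p3 k
      + (pairing p1 p2 k + pairing p2 p1 k) + (pairing p1 p3 k + pairing p3 p1 k)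
      + (pairing p2 p3 k + pairing p3 p2 k)) < lam * (3 / 8).
    by rewrite ltr_pM2l //; lra.
  by rewrite /EL /lam; move: W0; rewrite /W; lra.
have i0 Q u : 0 <= ind Q u := ind_ge0 Q u.
have m0 Q : 0 <= mean (ind Q) w by apply: mean_ge0.
have lfA Q := mulr_ge0 (ltW lam0) (f0 _ _ (i0 A) (i0 Q)).
have lfQ Q Q' := mulr_ge0 (ltW lam0) (f0 _ _ (i0 Q) (i0 Q')).
move: (m0 Q1) (m0 Q2) (m0 Q3) (lfA Q1) (lfA Q2) (lfA Q3).
move: (lfQ Q1 Q2) (lfQ Q2 Q1) (lfQ Q1 Q3) (lfQ Q3 Q1) (lfQ Q2 Q3) (lfQ Q3 Q2) => *.
have lt1 (y : R) : lam * y < lam -> y < 1.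
  by rewrite -[X in _ < X]mulr1 ltr_pM2l.
exists Q1, Q2, Q3; split=> //; split.
- by rewrite -/W -/lam; lra.
- by split; apply: clash_freeP; apply: lt1; rewrite -/k; lra.
- by split; apply: clash_freeP; apply: lt1; rewrite -/k; lra.
- by split; apply: clash_freeP; apply: lt1; rewrite -/k; lra.
Qed.

Lemma dominated_mono F G p q : (forall Q, F Q -> G Q) -> (forall u, p u <= q u) ->
  dominated F p -> dominated G q.
Proof.
move=> FG pq D w w0; have [Q FQ Qp] := D w w0; exists Q; first exact: FG.
by apply: le_trans Qp _; apply: mean_le => // u; apply: ltW.
Qed.

Lemma dominated_or F G p q : dominated F p -> dominated G q ->
  dominated (fun Q => F Q \/ G Q) (fun u => p u / 2 + q u / 2).
Proof.
move=> DF DG w w0; have [Q FQ Qp] := DF w w0; have [Q' GQ' Qq] := DG w w0.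
have E : mean (fun u => p u / 2 + q u / 2) w = (mean p w + mean q w) / 2.
  rewrite meanDl mulrDl ![_ / 2]mulrC -!meanZl.
  by congr (_ + _); apply: eq_bigr => u _; rewrite [_ / 2]mulrC.
rewrite E; have [le_pq|/ltW le_qp] := lerP (mean p w) (mean q w).
  by exists Q; [left|lra].
by exists Q'; [right|lra].
Qed.

Lemma dominated_setU F p (A : {set T}) : dominated F p ->
  dominated (fun Q' => exists2 Q, F Q & Q' = A :|: Q) (fun u => ind A u + p u).
Proof.
move=> D w w0; have [Q FQ Qp] := D w w0; exists (A :|: Q); first by exists Q.
rewrite meanDl; apply: le_trans (mean_indU _ _ _) _ => [u|]; first exact: ltW.
by rewrite lerD2l.
Qed.
End Domination.

(** * Subtrees of the complete binary tree *)

Section Tree.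
Variable h : nat.
Local Notation T := {bseq h of bool}.
Implicit Types u v x c : T.

Definition child (b : bool) v : T := insub_bseq h (b :: v).

Lemma child_val b v : size v < h -> child b v = b :: v :> seq bool.
Proof. by move=> vh; rewrite /child val_insubd /= vh. Qed.

Lemma size_child b v : size v < h -> size (child b v) = (size v).+1.
Proof. by move=> vh; rewrite child_val. Qed.

Lemma child_is_child b v : size v < h -> is_child v (child b v).
Proof. by move=> vh; apply/existsP; exists b; apply/eqP/child_val. Qed.

Lemma is_child_size v u : is_child v u -> size u = (size v).+1.
Proof. by case/existsP => b /eqP ->. Qed.

Lemma suffix_child v u : size v < h ->
  suffix v u = [|| u == v, suffix (child false v) u | suffix (child true v) u].
Proof.
move=> vh; rewrite !child_val //; apply/idP/idP => [/suffixP [w uw]|].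
  case/lastP: w uw => [|w b'] uw.
    by rewrite -val_eqE /= uw eqxx.
  apply/orP; right; rewrite cat_rcons in uw.
  have s : suffix (b' :: v) u by rewrite uw suffix_suffix.
  by case: b' s {uw} => ->; rewrite ?orbT.
case/or3P => [/eqP ->|/suffixP [w ->]|/suffixP [w ->]]; rewrite ?suffix_refl //.
  by rewrite -cat_rcons suffix_suffix.
by rewrite -cat_rcons suffix_suffix.
Qed.

Lemma suffix_size v u : suffix v u -> size v <= size u.
Proof. exact: size_suffix. Qed.

Section Spread.
Local Open Scope ring_scope.
Variable R : realFieldType.
Implicit Types p : nat -> R.

(** The depth profile [p] transported to the subtree below [v]. *)
Definition spread p v (u : T) : R := if suffix v u then p (size u - size v)%N else 0.

Lemma spread_ge0 p v u : (forall s, 0 <= p s) -> 0 <= spread p v u.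
Proof. by move=> p0; rewrite /spread; case: ifP. Qed.

Lemma spread_split p v u : (size v < h)%N ->
  spread p v u = (u == v)%:R * p 0 + spread (fun s => p s.+1) (child false v) u
                 + spread (fun s => p s.+1) (child true v) u.
Proof.
move=> vh; have [->|uv] := eqVneq u v.
  rewrite /spread suffix_refl subnn mul1r.
  have no b : suffix (child b v) v = false.
    by apply/negP => /suffix_size; rewrite size_child // ltnn.
  by rewrite !no !addr0.
rewrite mul0r add0r /spread suffix_child // (negPf uv) /=.
have arith b : suffix (child b v) u ->
    (size u - size v = (size u - size (child b v)).+1)%N.
  by move=> /suffix_size; rewrite size_child // => ?; lia.
have excl : suffix (child false v) u -> suffix (child true v) u -> False.
  by rewrite !suffixE !size_child // !child_val // => /eqP -> /eqP.
case: ifP => [/orP [s|s]|/norP [/negPf -> /negPf ->]]; last by rewrite addr0.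
  have -> : suffix (child true v) u = false by apply/negbTE/negP; exact: excl.
  by rewrite s addr0 (arith false).
have -> : suffix (child false v) u = false.
  by apply/negbTE/negP => s'; exact: excl s.
by rewrite s add0r (arith true).
Qed.

Lemma spread_leaf p v u : (h <= size v)%N -> spread p v u = (u == v)%:R * p 0.
Proof.
move=> hv; have [->|uv] := eqVneq u v.
  by rewrite /spread suffix_refl subnn mul1r.
rewrite mul0r /spread; case: ifP => // /suffixP [w uw].
have := size_bseq u; rewrite uw size_cat => wh.
have w0 : w = [::].
  by apply/nilP; rewrite /nilp -leqn0 -(leq_add2r (size v)) (leq_trans wh).
by move: uv; rewrite -val_eqE /= uw w0 eqxx.
Qed.

(** The subtree below [v] has 2^s vertices at depth s. *)
Lemma mean_spread_level p (c : nat -> R) v :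
  mean (spread p v) (fun u => c (size u)) =
  \sum_(s < (h - size v).+1) 2 ^+ s * p s * c (size v + s)%N.
Proof.
have [m] := ubnP (h - size v); elim: m => // m IH in p v *; rewrite ltnS => hm.
have [hv|vh] := leqP h (size v).
  rewrite (_ : (h - size v = 0)%N); last by apply/eqP.
  rewrite big_ord_recl big_ord0 addr0 expr0 mul1r addn0.
  rewrite -[RHS](mean_pred1 v (fun u => p 0%N * c (size u))).
  by apply: eq_bigr => u _; rewrite spread_leaf // mulrA.
have -> : mean (spread p v) (fun u => c (size u)) =
    p 0%N * c (size v)
    + mean (spread (fun s => p s.+1) (child false v)) (fun u => c (size u))
    + mean (spread (fun s => p s.+1) (child true v)) (fun u => c (size u)).
  rewrite -(mean_pred1 v (fun u => p 0%N * c (size u))) -!big_split /=.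
  by apply: eq_bigr => u _; rewrite spread_split // mulrA !mulrDl.
rewrite !IH ?size_child //; [|lia|lia].
rewrite [RHS]big_ord_recl expr0 mul1r addn0 -addrA; congr (_ + _).
rewrite -big_split /= (_ : (h - size v = (h - (size v).+1).+1)%N); last lia.
by apply: eq_bigr => s _; rewrite addSnnS /bump /= exprS; lra.
Qed.
End Spread.

(** * Colours, layers and clashes *)

Section Embedding.
Variables (H : sgraph) (n : nat).
Variable f : complete_binary_tree h -> strong_product H (path_graph n).
Hypothesis f_emb : subgraph_embedding f.

Definition colour u : H := (f u).1.
Definition layer u : nat := (f u).2.

Lemma colour_layer_inj u u' : colour u = colour u' -> layer u = layer u' -> u = u'.
Proof.
rewrite /colour /layer => cu lu; apply: f_emb.1.
by apply/eqP; rewrite -pair_eqE /pair_eq cu eqxx /=; apply/eqP/val_inj.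
Qed.

Lemma embedding_child v u : is_child v u ->
  (colour v = colour u \/ adj (colour v) (colour u)) /\
  (layer u <= (layer v).+1 /\ layer v <= (layer u).+1).
Proof.
move=> vu; have /f_emb.2 /= : adj (v : complete_binary_tree h) u.
  by rewrite /= /cbt_adj vu.
rewrite /strong_adj /colour /layer /= /path_adj.
case/or3P => /andP [].
- by move=> /eqP -> l; split; [left|move: l => /orP [] /eqP; lia].
- by move=> /eqP -> c; split; [right|lia].
by move=> c l; split; [right|move: l => /orP [] /eqP; lia].
Qed.

Lemma layer_suffix v u : suffix v u ->
  maxn (layer u - layer v) (layer v - layer u) <= size u - size v.
Proof.
case/suffixP => w; elim: w u => [|b w IH] u uw.
  by rewrite (val_inj uw : u = v) !subnn.
have := size_bseq u; rewrite uw /= => wh.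
have sz : size (w ++ v) <= h by apply: leq_trans wh.
pose u' : T := Bseq sz.
have u'u : is_child u' u by apply/existsP; exists b; apply/eqP.
have := IH u' erefl; have [_ [l1 l2]] := embedding_child u'u.
rewrite /= size_cat /=; move: (size w) (size v) => *; lia.
Qed.
End Embedding.
End Tree.

Section Clashes.
Local Open Scope ring_scope.
Variable R : realFieldType.
Variables (h : nat) (H : sgraph) (n : nat).
Variable f : complete_binary_tree h -> strong_product H (path_graph n).
Hypothesis f_emb : subgraph_embedding f.
Local Notation T := {bseq h of bool}.
Implicit Types u v x c : T.

(** Only pairs with the deeper vertex at depth at least 16 count: equal colours
    near the root are common and harmless, as these vertices are not among those
    whose colours fill a bag. Listing the shallower vertex first lets the
    expected number be bounded by summing over the deeper one, where
    probabilities are smallest. *)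
Definition clash v : rel T := fun u u' =>
  [&& colour f u == colour f u', (size u <= size u')%N & (size v + 16 <= size u')%N].

(** A common bound for the inclusion probabilities of the whole construction at a
    vertex, as if all four vertices at depth 2 were used. *)
Definition hull_profile (s : nat) : R :=
  if s is s'.+2 then branch_profile R s' else 1.

Lemma profile_ge0 s : 0 <= profile R s.
Proof. by rewrite exprn_ge0 ?decay_ge0. Qed.

Lemma branch_profile_ge0 s : 0 <= branch_profile R s.
Proof. by apply: iter_lift_profile_ge0 => t; apply: profile_ge0. Qed.

Lemma hull_profile_large s : (16 <= s)%N ->
  hull_profile s = 2^-1 ^+ 14 * decay R ^+ (s - 19).
Proof.
move=> s16; rewrite -(subnKC s16) /= /branch_profile iter_lift_profile_large.
by rewrite /profile; congr (_ * _ ^+ _); lia.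
Qed.

(** The clashing vertices have one colour, hence distinct layers, and the layer
    distance to [v] is at most the depth. So the sum over vertices is at most
    the sum over layers of the value at the least depth the layer permits. *)
Lemma clash_row_le v u :
  mean (spread hull_profile v) (fun u' => (clash v u u')%:R)
  <= clash_bound R (size u - size v).
Proof.
set a := maxn (size u - size v) 19.
pose G (y : nat) : R :=
  decay R ^+ (maxn a (maxn (y - layer f v) (layer f v - y)) - 19).
have G0 y : 0 <= G y by rewrite exprn_ge0 ?decay_ge0.
have half0 : 0 <= 2^-1 ^+ 14 :> R by rewrite exprn_ge0 // invr_ge0.
pose C : pred T := fun u' => colour f u == colour f u'.
apply: (@le_trans _ _ (\sum_(u' | C u') 2^-1 ^+ 14 * G (layer f u'))).
  rewrite [leRHS]big_mkcond; apply: ler_sum => u' _.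
  rewrite /spread /clash /C.
  case: eqP => _; last by rewrite mulr0.
  case: ifP => [vu'|_]; last by rewrite mul0r mulr_ge0.
  case: andP => [[uu' s16]|_]; last by rewrite mulr0 mulr_ge0.
  rewrite mulr1 hull_profile_large; last by lia.
  rewrite ler_wpM2l //; apply: decayX_anti.
  by have := layer_suffix f_emb vu'; rewrite /a; lia.
rewrite -mulr_sumr ler_wpM2l //.
pose L (u' : T) : 'I_n.+1 := (f u').2.
have Linj : {in C &, injective L}.
  move=> x y /eqP cx /eqP cy Lxy; apply: (colour_layer_inj f_emb).
    by rewrite -cx -cy.
  by rewrite /layer -!/(L _) Lxy.
have -> : \sum_(u' | C u') G (layer f u') = \sum_(y in L @: C) G y.
  by rewrite big_imset.
apply: (@le_trans _ _ (\sum_(y < n.+1) G y)).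
  rewrite big_mkcond; apply: ler_sum => y _; case: ifP => // _.
by apply: layer_sum_le; rewrite leq_maxr.
Qed.

End Clashes.

(** * Limbs and crossed bags *)

Section Limbs.
Variables (h : nat) (H : sgraph) (n : nat).
Variable f : complete_binary_tree h -> strong_product H (path_graph n).
Hypothesis f_emb : subgraph_embedding f.
Variable B : seq {set H}.
Hypothesis B_dec : path_decomposition B.
Local Notation T := {bseq h of bool}.
Local Notation bag := (nth set0 B).
Implicit Types (u v x c r : T) (Q X A : {set T}).

(** A subtree with root [v], described by closure under parents. *)
Definition rooted v Q : Prop :=
  v \in Q /\ forall u, u \in Q -> u != v -> exists2 p, p \in Q & is_child p u.

Definition rich k A : Prop :=
  exists2 i, i < size B & k <= #|bag i :&: (colour f @: A)|.

(** The part that remains when a limb has been lengthened at its root [e] times. *)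
Definition core e v Q : {set T} := [set u in Q | size v + e <= size u].

Definition limb k e v Q : Prop := rooted v Q /\ rich k (core e v Q).

Lemma rooted1 v : rooted v [set v].
Proof. by split=> [|u]; rewrite inE // => /eqP ->; rewrite eqxx. Qed.

Lemma rooted_graft v c r X Q : rooted v X -> c \in X -> is_child c r ->
  rooted r Q -> rooted v (X :|: Q).
Proof.
move=> [vX Xp] cX cr [rQ Qp]; split=> [|u]; first by rewrite inE vX.
rewrite inE => /orP [uX uv|uQ uv].
  by have [p pX pu] := Xp _ uX uv; exists p; rewrite // inE pX.
have [->|ur] := eqVneq u r; first by exists c; rewrite // inE cX.
by have [p pQ pu] := Qp _ uQ ur; exists p; rewrite // inE pQ orbT.
Qed.

Lemma rooted_ind v X (P : pred T) : rooted v X ->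
  (forall p u, p \in X -> u \in X -> is_child p u -> P p -> P u) ->
  P v -> forall u, u \in X -> P u.
Proof.
move=> [vX Xp] step Pv u; have [m] := ubnP (size u).
elim: m u => // m IH u; rewrite ltnS => um uX.
have [->|uv] := eqVneq u v; first by [].
have [p pX pu] := Xp _ uX uv.
have Pp : P p by apply: IH => //; rewrite -(is_child_size pu).
exact: step pX uX pu Pp.
Qed.

Lemma rooted_size v X u : rooted v X -> u \in X -> size v <= size u.
Proof.
move=> rX; apply: (rooted_ind (P := fun u => size v <= size u) rX) => //.
by move=> p w _ _ /is_child_size -> pv; apply: leqW.
Qed.

Lemma common_bag p u : is_child p u ->
  exists2 i, i < size B & (colour f p \in bag i) && (colour f u \in bag i).
Proof.
case/(embedding_child f_emb) => -[<-|adj_pu] _; last exact: B_dec.2.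
have [i [j [ij jB iB]]] := B_dec.1 (colour f p).
have iB' := leq_ltn_trans ij jB.
by exists i; rewrite // andbb iB // leqnn ij.
Qed.

Lemma bag_between (x : H) i j l : i <= j -> j <= l -> l < size B ->
  x \in bag i -> x \in bag l -> x \in bag j.
Proof.
move=> ij jl lB; have [a [b [ab bB mem]]] := B_dec.1 x.
have jB := leq_ltn_trans jl lB; have iB := leq_ltn_trans ij jB.
rewrite !mem // => /andP [ai _] /andP [_ lb].
by rewrite (leq_trans ai ij) (leq_trans jl lb).
Qed.

(** A connected set that meets a bag on either side of bag [j] meets bag [j]:
    otherwise each vertex would lie strictly left or strictly right of [j], and
    adjacent vertices, sharing a bag, would lie on the same side. *)
Lemma rooted_crosses v X u u' i j l : rooted v X -> u \in X -> u' \in X ->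
  i <= j -> j <= l -> l < size B ->
  colour f u \in bag i -> colour f u' \in bag l ->
  exists2 x, x \in X & colour f x \in bag j.
Proof.
move=> rX uX u'X ij jl lB ui u'l; apply/exists_inP; apply: contraT.
move=> /exists_inPn /= none.
have jB := leq_ltn_trans jl lB.
pose left x := [exists t : 'I_j, colour f x \in bag t].
have leftP x t : x \in X -> t < size B -> colour f x \in bag t -> left x = (t < j).
  move=> xX tB xt; have [tj|jt] := ltnP t j.
    by apply/existsP; exists (Ordinal tj).
  apply/negbTE/negP => /existsP [s xs]; case/negP: (none _ xX).
  by apply: bag_between xs xt => //; apply: ltnW.
have same p w : p \in X -> w \in X -> is_child p w -> left p = left w.
  move=> pX wX /common_bag [t tB /andP [pt wt]].
  by rewrite (leftP _ t) // (leftP _ t).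
have all_v w : w \in X -> left w = left v.
  move=> wX; apply: (elimT eqP).
  apply: (rooted_ind (P := fun w => left w == left v) rX) wX => //.
  by move=> p y pX yX py; rewrite (same p y).
have : left u = left u' by rewrite !all_v.
rewrite (leftP u i) //; last by apply: leq_ltn_trans jB.
rewrite (leftP u' l) // [l < j]ltnNge jl /= => /negbT.
rewrite -leqNgt => ji; have ij' : i = j by apply/eqP; rewrite eqn_leq ij.
by case/negP: (none _ uX); rewrite -ij'.
Qed.

Lemma rich_crossed v X A k i j l u u' : rooted v X -> u \in X -> u' \in X ->
  i <= j -> j <= l -> l < size B ->
  colour f u \in bag i -> colour f u' \in bag l ->
  (forall x y, x \in X -> y \in A -> colour f x != colour f y) ->
  k <= #|bag j :&: (colour f @: A)| -> rich k.+1 (X :|: A).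
Proof.
move=> rX uX u'X ij jl lB ui u'l disj kA.
have [x xX xj] := rooted_crosses rX uX u'X ij jl lB ui u'l.
exists j; first by apply: leq_ltn_trans lB.
apply: (@leq_trans #|colour f x |: (bag j :&: (colour f @: A))|).
  suff /negPf xn : colour f x \notin bag j :&: (colour f @: A).
    by rewrite cardsU1 xn add1n.
  apply/negP; rewrite inE xj /= => /imsetP [y yA xy].
  by case/negP: (disj x y xX yA); apply/eqP.
apply/subset_leq_card/subsetP => z; rewrite !inE => /orP [/eqP ->|/andP [zj]].
  by rewrite xj imset_f // inE xX.
by case/imsetP => y yA zy; rewrite zj zy imset_f // inE yA orbT.
Qed.

Lemma rich_mono k A A' : A \subset A' -> rich k A -> rich k A'.
Proof.
move=> AA' [i iB kA]; exists i => //; apply: leq_trans kA _.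
by apply/subset_leq_card/setIS/imsetS.
Qed.
Lemma rich_member k A i : 0 < k -> k <= #|bag i :&: (colour f @: A)| ->
  exists2 u, u \in A & colour f u \in bag i.
Proof.
move=> k0 kA; have /card_gt0P [z] := leq_trans k0 kA.
by rewrite inE => /andP [zi /imsetP [u uA zu]]; exists u; rewrite // -zu.
Qed.

Definition far v Q : {set T} := core 16 v Q.

Definition colour_disjoint X A : Prop :=
  forall x y, x \in X -> y \in A -> colour f x != colour f y.

(** A lengthened limb with its bag made explicit, so that the bags of three arms
    can be put in order. *)
Definition arm_at k v (i : nat) c Q : Prop :=
  exists r, [/\ is_child c r, rooted r Q, i < size B &
                k <= #|bag i :&: (colour f @: far v Q)|].

Lemma far_disjoint v X Q :
  clash_free (clash f v) X Q -> clash_free (clash f v) Q X ->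
  colour_disjoint X (far v Q).
Proof.
move=> XQ QX x y xX; rewrite inE => /andP [yQ sy]; apply/negP => /eqP cxy.
have [le_xy|lt_yx] := leqP (size x) (size y).
  by move: (XQ _ _ xX yQ); rewrite /clash cxy eqxx le_xy sy.
have sx := leq_trans sy (ltnW lt_yx).
by move: (QX _ _ yQ xX); rewrite /clash cxy eqxx (ltnW lt_yx) sx.
Qed.

Lemma near_far_disjoint v X Q : (forall u, u \in X -> size u < size v + 16) ->
  clash_free (clash f v) X Q -> colour_disjoint X (far v Q).
Proof.
move=> Xnear XQ; apply: far_disjoint XQ _ => y x _ xX.
by rewrite /clash [_ + 16 <= _]leqNgt Xnear // !andbF.
Qed.

(** The heart of the lower bound for pathwidth: the union of the outer two limbs
    and [X], which connects them, crosses the bag of the middle limb in a colour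
    that is not yet counted there. *)
Lemma middle_rich k v X ca cb cc Qa Qb Qc ia ib ic :
  0 < k -> rooted v X -> ca \in X -> cc \in X ->
  arm_at k v ia ca Qa -> arm_at k v ib cb Qb -> arm_at k v ic cc Qc ->
  colour_disjoint X (far v Qb) -> colour_disjoint Qa (far v Qb) ->
  colour_disjoint Qc (far v Qb) ->
  ia <= ib <= ic -> rich k.+1 (X :|: Qa :|: Qb :|: Qc).
Proof.
move=> k0 rX caX ccX [ra [car rQa iaB ka]] [rb [_ _ ibB kb]] [rc [ccr rQc icB kc]].
move=> Xb ab cb' /andP [iab ibc].
have rY : rooted v (X :|: Qa :|: Qc).
  apply: rooted_graft ccr rQc; last by rewrite inE ccX.
  exact: rooted_graft car rQa.
have [u uA ui] := rich_member k0 ka; have [w wA wi] := rich_member k0 kc.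
have uY : u \in X :|: Qa :|: Qc.
  by move: uA; rewrite !inE => /andP [-> _]; rewrite orbT.
have wY : w \in X :|: Qa :|: Qc.
  by move: wA; rewrite !inE => /andP [-> _]; rewrite orbT.
apply: (@rich_mono _ (X :|: Qa :|: Qc :|: far v Qb)).
  rewrite setUAC; apply/setSU/setUS.
  by apply/subsetP => x; rewrite inE => /andP [].
apply: (rich_crossed rY uY wY iab ibc icB ui wi _ kb) => x y xY yb.
by move: xY; rewrite !inE -orbA => /or3P []; move=> ?; [exact: Xb|exact: ab|exact: cb'].
Qed.

(** In a claw of a single colour, the three leaves would lie in distinct layers
    next to the layer of the centre [u], and there are only two of these. So some
    edge has two colours, and a bag contains both. *)
Lemma claw_rich v u (c0 c1 : T) :
  is_child v u -> is_child u c0 -> is_child u c1 -> c0 != c1 ->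
  rich 2 [set v; u; c0; c1].
Proof.
move=> vu uc0 uc1 c01.
have edge p w : is_child p w -> p \in [set v; u; c0; c1] -> w \in [set v; u; c0; c1] ->
    colour f p != colour f w -> rich 2 [set v; u; c0; c1].
  move=> pw pA wA npw; have [i iB /andP [pi wi]] := common_bag pw.
  exists i => //; apply: (@leq_trans #|[set colour f p; colour f w]|).
    by rewrite cards2 npw.
  apply/subset_leq_card/subsetP => z; rewrite !inE => /orP [] /eqP ->.
    by rewrite pi imset_f.
  by rewrite wi imset_f.
have [ev|] := eqVneq (colour f v) (colour f u); last first.
  by apply: edge => //; rewrite !inE eqxx ?orbT.
have [e0|] := eqVneq (colour f u) (colour f c0); last first.
  by apply: edge => //; rewrite !inE eqxx ?orbT.
have [e1|] := eqVneq (colour f u) (colour f c1); last first.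
  by apply: edge => //; rewrite !inE eqxx ?orbT.
have neq x y : colour f x = colour f y -> x != y -> layer f x <> layer f y.
  by move=> cxy /negP xy lxy; apply/xy/eqP/(colour_layer_inj f_emb).
have below x y : colour f x = colour f y -> size x < size y ->
    layer f x <> layer f y.
  by move=> cxy xy; apply: neq cxy _; apply: contraTneq xy => ->; rewrite ltnn.
have sv := is_child_size vu.
have s0 := is_child_size uc0; have s1 := is_child_size uc1.
have [_ l1] := embedding_child f_emb vu.
have [_ l2] := embedding_child f_emb uc0.
have [_ l3] := embedding_child f_emb uc1.
have n1 : layer f v <> layer f u by apply: below; rewrite // sv.
have n2 : layer f u <> layer f c0 by apply: below; rewrite // s0.
have n3 : layer f u <> layer f c1 by apply: below; rewrite // s1.
have n4 : layer f v <> layer f c0.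
  by apply: below; rewrite ?ev // s0 sv ltnS leqnSn.
have n5 : layer f v <> layer f c1.
  by apply: below; rewrite ?ev // s1 sv ltnS leqnSn.
have n6 : layer f c0 <> layer f c1 by apply: neq => //; rewrite -e0.
lia.
Qed.
End Limbs.

(** * Building limbs *)

Section Step.
Local Open Scope ring_scope.
Variables (R : realFieldType) (h : nat) (H : sgraph) (n : nat).
Variable f : complete_binary_tree h -> strong_product H (path_graph n).
Hypothesis f_emb : subgraph_embedding f.
Variable B : seq {set H}.
Hypothesis B_dec : path_decomposition B.
Local Notation T := {bseq h of bool}.
Implicit Types (u v x c r : T) (Q X A : {set T}) (p : nat -> R).

(** The inclusion probabilities of a random set below a random child of [c]. *)
Definition halves p c u : R :=
  spread p (child false c) u / 2 + spread p (child true c) u / 2.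

Lemma halves_ge0 p c u : (forall s, 0 <= p s) -> 0 <= halves p c u.
Proof. by move=> p0; rewrite addr_ge0 ?divr_ge0 ?spread_ge0. Qed.

Lemma spread_half p v u : spread (fun s => p s / 2) v u = spread p v u / 2.
Proof. by rewrite /spread; case: ifP; rewrite ?mul0r. Qed.

Lemma spread_lift p v u : (size v < h)%N ->
  spread (lift_profile p) v u = (u == v)%:R + halves p v u.
Proof. by move=> vh; rewrite spread_split //= !spread_half mulr1 addrA. Qed.

Definition limb_below k e c Q : Prop :=
  limb f B k e (child false c) Q \/ limb f B k e (child true c) Q.

Lemma dominated_below k e c p :
  (forall b, dominated (limb f B k e (child b c)) (spread p (child b c))) ->
  dominated (limb_below k e c) (halves p c).
Proof. by move=> D; apply: dominated_or. Qed.

Lemma limb_belowP k e c Q : (size c < h)%N -> limb_below k e c Q ->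
  exists r, [/\ is_child c r, size r = (size c).+1 & limb f B k e r Q].
Proof.
by move=> ch [L|L]; [exists (child false c)|exists (child true c)];
  rewrite size_child // child_is_child.
Qed.

Lemma dominated_lift k e v p : (size v < h)%N ->
  (forall b, dominated (limb f B k e (child b v)) (spread p (child b v))) ->
  dominated (limb f B k e.+1 v) (spread (lift_profile p) v).
Proof.
move=> vh D; apply: dominated_mono (dominated_setU [set v] (dominated_below D)).
  move=> _ [Q /(limb_belowP vh) [r [vr sr [rQ rk]]] ->]; split.
    by apply: rooted_graft vr rQ; [apply: rooted1|rewrite inE].
  apply: rich_mono rk; apply/subsetP => u; rewrite !inE sr addSnnS => /andP [-> ->].
  by rewrite orbT.
by move=> u; rewrite spread_lift // /ind inE.
Qed.

Lemma dominated_iter_lift k p m e v :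
  (forall u, (size u + m <= h)%N -> dominated (limb f B k 0 u) (spread p u)) ->
  (size v + (e + m) <= h)%N ->
  dominated (limb f B k e v) (spread (iter e (@lift_profile R) p) v).
Proof.
move=> D; elim: e v => [|e IH] v vh; first exact: D.
have vh' : (size v < h)%N by lia.
by apply: dominated_lift => // b; apply: IH; rewrite size_child //; lia.
Qed.

Lemma spread_hull v u : (size v + 3 <= h)%N ->
  spread (hull_profile R) v u = (u == v)%:R
   + ((u == child false v)%:R
      + spread (branch_profile R) (child false (child false v)) u
      + spread (branch_profile R) (child true (child false v)) u)
   + ((u == child true v)%:R
      + spread (branch_profile R) (child false (child true v)) u
      + spread (branch_profile R) (child true (child true v)) u).
Proof.
move=> vh; have v1 : (size v < h)%N by lia.
have v2 b : (size (child b v) < h)%N by rewrite size_child //; lia.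
by rewrite spread_split // !(spread_split _ _ (v2 _)) /= !mulr1.
Qed.

Lemma le_spread p q v u : (forall s, p s <= q s) -> spread p v u <= spread q v u.
Proof. by move=> pq; rewrite /spread; case: ifP. Qed.

Local Notation arm := (arm_profile R).

Lemma spread_profile_drop2 c u : (size c < h)%N ->
  (u == c)%:R + 8 / 5 * halves arm c u <= spread (fun s => profile R s.+2) c u.
Proof.
move=> ch; rewrite spread_split // -addrA lerD //.
  by rewrite /profile /= expr0 mulr1.
have scale r : 8 / 5 * (spread arm r u / 2) <= spread (fun s => profile R s.+3) r u.
  rewrite -spread_half.
  apply: (@le_trans _ _ (spread (fun s => 8 / 5 * (arm s / 2)) r u)).
    by rewrite /spread; case: ifP => // _; rewrite mulr0.
  by apply: le_spread => s; apply: (branch_profile_le R (s := s.+1)).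
by rewrite /halves mulrDr lerD.
Qed.

Lemma arm_ge0 s : 0 <= arm s.
Proof. by apply: iter_lift_profile_ge0 => t; apply: profile_ge0. Qed.

Section AtVertex.
Variable v : T.
Hypothesis vh : (size v + 3 <= h)%N.
Local Notation p0 := (child false v).
Local Notation p1 := (child true v).
Local Notation c1 := (child false p0).
Local Notation c2 := (child true p0).
Local Notation c3 := (child false p1).

(** The vertices that every limb built at [v] contains: they join the three arms, which
    start at the children of [c1], [c2] and [c3]. *)
Definition crown : {set T} := [set v; p0; p1; c1; c2; c3].

Definition crown_mass (u : T) : R :=
  (u == v)%:R + (u == p0)%:R + (u == p1)%:R
  + (u == c1)%:R + (u == c2)%:R + (u == c3)%:R.

Let v1 : (size v < h)%N. Proof. by apply: leq_trans vh; rewrite addn3 ltnS leqW. Qed.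
Let v2 b : (size (child b v) < h)%N.
Proof. by rewrite size_child //; apply: leq_trans vh; rewrite addn3. Qed.
Let s1 b : size (child b v) = (size v).+1. Proof. exact: size_child. Qed.
Let s2 b b' : size (child b' (child b v)) = (size v).+2.
Proof. by rewrite (size_child _ (v2 _)) s1. Qed.
Let v3 b b' : (size (child b' (child b v)) < h)%N.
Proof. by rewrite s2; apply: leq_trans vh; rewrite addn3. Qed.

Lemma crown_rooted : rooted v crown.
Proof.
have step (X : {set T}) c b : rooted v X -> c \in X -> (size c < h)%N ->
    rooted v (X :|: [set child b c]).
  by move=> rX cX ch; apply: rooted_graft rX cX (child_is_child _ ch) (rooted1 _).
do 5! [apply: (step _ _ _); [|by rewrite !inE eqxx ?orbT|by []]].
exact: rooted1.
Qed.

Lemma crown_size u : u \in crown -> (size u < size v + 16)%N.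
Proof.
by rewrite !inE -!orbA => /or4P [/eqP ->|/eqP ->|/eqP ->|/or3P [] /eqP ->];
  rewrite ?s2 ?s1; lia.
Qed.

Lemma ind_crown u : ind R crown u <= crown_mass u.
Proof.
have n0 (b : bool) : 0 <= b%:R :> R by apply: ler0n.
rewrite /ind !inE /crown_mass -!natrD ler_nat.
by do 6! case: (u == _).
Qed.

Let mass u := crown_mass u + halves arm c1 u + halves arm c2 u + halves arm c3 u.

Let massE u : mass u = (u == v)%:R + (u == p0)%:R + (u == p1)%:R
  + spread (branch_profile R) c1 u + spread (branch_profile R) c2 u
  + spread (branch_profile R) c3 u.
Proof.
have E b b' : spread (branch_profile R) (child b' (child b v)) u =
    (u == child b' (child b v))%:R + halves arm (child b' (child b v)) u.
  exact: spread_lift.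
by rewrite !E /mass /crown_mass; lra.
Qed.

(** Each row of the sum is bounded by [clash_row_le], which depends only on the
    depth of the first vertex; the rows are then added level by level. *)
Lemma clash_mass_lt : pairing mass mass (fun u u' => (clash f v u u')%:R) < 3 / 8.
Proof.
have br0 c u : 0 <= spread (branch_profile R) c u.
  by apply: spread_ge0 => s; apply: branch_profile_ge0.
have mass0 u : 0 <= mass u by rewrite massE !addr_ge0.
have mass_hull u : mass u <= spread (hull_profile R) v u.
  by rewrite massE spread_hull //; move: (br0 (child true p1) u) => ?; lra.
pose cb u := clash_bound R (size u - size v).
apply: (@le_lt_trans _ _ (mean mass cb)).
  apply: mean_ler => // u; apply: le_trans (clash_row_le R f_emb v u).
  by apply: mean_le => // u'; apply: ler0n.
have level b b' : mean (spread (branch_profile R) (child b' (child b v))) cb =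
    \sum_(r < (h - (size v).+2).+1)
      2 ^+ r * branch_profile R r * clash_bound R r.+2.
  rewrite (mean_spread_level _ (fun s => clash_bound R (s - size v))) s2.
  by apply: eq_bigr => r _; congr (_ * clash_bound R _); lia.
have -> : mean mass cb = cb v + cb p0 + cb p1
    + mean (spread (branch_profile R) c1) cb
    + mean (spread (branch_profile R) c2) cb
    + mean (spread (branch_profile R) c3) cb.
  rewrite -(mean_pred1 v cb) -(mean_pred1 p0 cb) -(mean_pred1 p1 cb) -!meanDl.
  by apply: eq_bigr => u _; rewrite massE.
rewrite !level /cb !s1 subnn subSnn.
have := clash_bound_mass_lt R (h - (size v).+2).+1.
by move: (\sum_(_ < _) _) (clash_bound R 0) (clash_bound R 1) => *; lra.
Qed.

(** The crown is paid for by the value 1 of [profile] up to depth 2, and the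
    conditioned arms by [branch_profile_le]. *)
Lemma crown_weight_le (w : T -> R) : (forall u, 0 < w u) ->
  mean (ind R crown) w
    + 8 / 5 * (mean (halves arm c1) w + mean (halves arm c2) w + mean (halves arm c3) w)
  <= mean (spread (profile R) v) w.
Proof.
move=> w0.
have -> : 8 / 5 * (mean (halves arm c1) w + mean (halves arm c2) w
                   + mean (halves arm c3) w)
    = mean (fun u => 8 / 5 * (halves arm c1 u + halves arm c2 u + halves arm c3 u)) w.
  by rewrite meanZl !meanDl.
rewrite -meanDl; apply: mean_le => u; last exact: ltW.
apply: (@le_trans _ _ (crown_mass u
   + 8 / 5 * (halves arm c1 u + halves arm c2 u + halves arm c3 u))).
  by rewrite lerD2r ind_crown.
rewrite spread_split // !(spread_split _ _ (v2 _)) /=.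
have := spread_profile_drop2 u (v3 false false).
have := spread_profile_drop2 u (v3 false true).
have := spread_profile_drop2 u (v3 true false).
have : 0 <= spread (fun s => profile R s.+2) (child true p1) u.
  by apply: spread_ge0 => s; apply: profile_ge0.
have -> : profile R 0 = 1 by rewrite /profile /= expr0.
have -> : profile R 1 = 1 by rewrite /profile /= expr0.
by rewrite /crown_mass -/arm => *; lra.
Qed.

(** Three disjointly coloured limbs for k colours give one for k+1. *)
Lemma dominated_limb_step k : (0 < k)%N ->
  (forall r, size r = (size v).+3 -> dominated (limb f B k 13 r) (spread arm r)) ->
  dominated (limb f B k.+1 0 v) (spread (profile R) v).
Proof.
move=> k0 D w w0.
have Dc b b' : dominated (limb_below k 13 (child b' (child b v)))
    (halves arm (child b' (child b v))).
  by apply: dominated_below => b''; apply: D; rewrite size_child // s2.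
have arm_mass_ge0 c u : 0 <= halves arm c u by apply: halves_ge0; apply: arm_ge0.
have pos : exists u, 0 < halves arm c1 u.
  exists (child false c1); rewrite /halves ltr_pwDl ?divr_ge0 ?spread_ge0 //.
    by rewrite /spread suffix_refl subnn /arm /=; lra.
  exact: arm_ge0.
have [Q1 [Q2 [Q3 [[F1 F2 F3] [le_w free_sh free_lt free_gt]]]]] :=
  dominated_clash_free (Dc _ _) (Dc _ _) (Dc _ _)
    (arm_mass_ge0 c1) (arm_mass_ge0 c2) (arm_mass_ge0 c3) pos ind_crown clash_mass_lt w0.
case: free_sh => free01 free02 free03; case: free_lt => free12 free13 free23.
case: free_gt => free21 free31 free32.
exists (crown :|: Q1 :|: Q2 :|: Q3); last first.
  apply: le_trans (crown_weight_le w0).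
  have U (X Y : {set T}) := mean_indU (R := R) X Y (fun u => ltW (w0 u)).
  move: (U (crown :|: Q1 :|: Q2) Q3) (U (crown :|: Q1) Q2) (U crown Q1) le_w.
  by move=> *; lra.
have armP b b' Q : limb_below k 13 (child b' (child b v)) Q ->
    exists i, arm_at f B k v i (child b' (child b v)) Q.
  move=> /(limb_belowP (v3 _ _)) [r [cr sr [rQ [i iB ki]]]]; exists i, r; split=> //.
  by move: ki; rewrite /far /core sr s2 !addSnnS.
have [i1 A1] := armP _ _ _ F1; have [i2 A2] := armP _ _ _ F2.
have [i3 A3] := armP _ _ _ F3.
have c1S : c1 \in crown by rewrite !inE eqxx ?orbT.
have c2S : c2 \in crown by rewrite !inE eqxx ?orbT.
have c3S : c3 \in crown by rewrite !inE eqxx ?orbT.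
have rQ : rooted v (crown :|: Q1 :|: Q2 :|: Q3).
  case: A1 A2 A3 => [r1 [cr1 rQ1 _ _]] [r2 [cr2 rQ2 _ _]] [r3 [cr3 rQ3 _ _]].
  apply: rooted_graft cr3 rQ3; last by rewrite in_setU (in_setU c3) c3S.
  apply: rooted_graft cr2 rQ2; last by rewrite in_setU c2S.
  exact: rooted_graft crown_rooted c1S cr1 rQ1.
split=> //; apply: (@rich_mono _ _ _ f B _ (crown :|: Q1 :|: Q2 :|: Q3)).
  by apply/subsetP => u uQ; rewrite inE uQ addn0 (rooted_size rQ).
have mid := middle_rich f_emb B_dec k0 crown_rooted.
have D0 := near_far_disjoint crown_size.
have D12 := far_disjoint free12 free21; have D21 := far_disjoint free21 free12.
have D13 := far_disjoint free13 free31; have D31 := far_disjoint free31 free13.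
have D23 := far_disjoint free23 free32; have D32 := far_disjoint free32 free23.
(* Whichever bag comes between the other two is the one that gains a colour. *)
have [le12|/ltnW le21] := leqP i1 i2; have [le23|/ltnW le32] := leqP i2 i3.
- by apply: mid A1 A2 A3 _ _ _ _ => //; [apply: D0|rewrite le12].
- have [le13|/ltnW le31] := leqP i1 i3.
    rewrite setUAC.
    by apply: mid A1 A3 A2 _ _ _ _ => //; [apply: D0|rewrite le13].
  rewrite setUAC (setUAC crown).
  by apply: mid A3 A1 A2 _ _ _ _ => //; [apply: D0|rewrite le31].
- have [le13|/ltnW le31] := leqP i1 i3.
    rewrite (setUAC crown).
    by apply: mid A2 A1 A3 _ _ _ _ => //; [apply: D0|rewrite le21].
  rewrite (setUAC crown) setUAC.
  by apply: mid A2 A3 A1 _ _ _ _ => //; [apply: D0|rewrite le23].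
rewrite setUAC (setUAC crown) setUAC.
by apply: mid A3 A2 A1 _ _ _ _ => //; [apply: D0|rewrite le32].
Qed.
End AtVertex.

Lemma spread_root p c u : (forall s, 0 <= p s) -> (u == c)%:R * p 0%N <= spread p c u.
Proof.
move=> p0; have [->|_] := eqVneq u c; last by rewrite mul0r spread_ge0.
by rewrite /spread suffix_refl subnn mul1r.
Qed.

Lemma dominated_limb_two v : (size v + 2 <= h)%N ->
  dominated (limb f B 2 0 v) (spread (profile R) v).
Proof.
move=> vh; set u := child false v; set c0 := child false u; set c1 := child true u.
have v1 : (size v < h)%N by apply: leq_trans vh; rewrite addn2.
have u1 : (size u < h)%N by rewrite size_child //; apply: leq_trans vh; rewrite addn2.
have c01 : c0 != c1.
  by apply/eqP => /(congr1 (@bseqval _ _)); rewrite !(child_val _ u1).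
have rQ : rooted v [set v; u; c0; c1].
  apply: rooted_graft (child_is_child _ u1) (rooted1 _); last by rewrite !inE eqxx ?orbT.
  apply: rooted_graft (child_is_child _ u1) (rooted1 _); last by rewrite !inE eqxx ?orbT.
  apply: rooted_graft (child_is_child _ v1) (rooted1 _); last by rewrite !inE eqxx.
  exact: rooted1.
move=> w w0; exists [set v; u; c0; c1].
  split=> //; apply: rich_mono (claw_rich f_emb B_dec (child_is_child _ v1)
    (child_is_child _ u1) (child_is_child _ u1) c01).
  by apply/subsetP => x xQ; rewrite inE xQ addn0 (rooted_size rQ).
apply: mean_le => x; last exact: ltW.
rewrite spread_split // (spread_split _ _ u1) -/u -/c0 -/c1.
have pr0 s : 0 <= profile R s by apply: profile_ge0.
move: (spread_root c0 x (fun s => pr0 s.+2)) (spread_root c1 x (fun s => pr0 s.+2)).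
have : 0 <= spread (fun s => profile R s.+1) (child true v) x by apply: spread_ge0.
rewrite /ind !inE /profile /= expr0 !mulr1.
move: (x == v) (x == u) (x == c0) (x == c1) => [] [] [] [] /= *; lra.
Qed.

(** One more colour costs 16 levels: 3 to the roots of the arms and 13 along them. *)
Lemma dominated_limb k v : (size v + (16 * k + 2) <= h)%N ->
  dominated (limb f B k.+2 0 v) (spread (profile R) v).
Proof.
elim: k v => [|k IH] v vh; first by apply: dominated_limb_two; rewrite muln0 in vh.
apply: dominated_limb_step => // [|r sr]; first by lia.
by apply: dominated_iter_lift IH _ => //; rewrite sr; lia.
Qed.
End Step.

(** * The lower bound *)

Lemma crowded_bag (h : nat) (H : sgraph) (n : nat)
    (f : complete_binary_tree h -> strong_product H (path_graph n))
    (B : seq {set H}) (k : nat) :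
  subgraph_embedding f -> path_decomposition B -> 16 * k + 2 <= h ->
  exists2 X, X \in B & k.+2 <= #|X|.
Proof.
move=> f_emb B_dec kh.
have root_h : size (insub_bseq h [::] : {bseq h of bool}) + (16 * k + 2) <= h.
  by rewrite val_insubd.
have [Q [_ [i iB ki]] _] := dominated_limb (R := rat) f_emb B_dec root_h
  (fun _ => ltr01).
exists (nth set0 B i); first exact: mem_nth.
by apply: leq_trans ki _; apply/subset_leq_card/subsetIl.
Qed.

Theorem theorem1 (h : nat) :
  (h + 1) %/ 16 <= row_pathwidth (complete_binary_tree h).
Proof.
rewrite /row_pathwidth; case: ex_minnP => k /asboolP [H [n [f f_emb]] pwH] _.
move: pwH; rewrite /pathwidth; case: ex_minnP => _ /asboolP [B B_dec <-] _ <-{k}.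
rewrite leqNgt; apply/negP => lt_w.
have [|X XB] := crowded_bag (k := width B) f_emb B_dec.
  have := leq_divM (h + 1) 16; move: lt_w.
  by move: (width B) ((h + 1) %/ 16) => a b; lia.
have : #|X| <= \max_(Y <- B) #|Y|.
  exact: (@leq_bigmax_seq _ _ xpredT (fun Y : {set H} => #|Y|)).
rewrite /width; move: (\max_(_ <- _) _) #|X| => a b; lia.
Qed.
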